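(* Let $p$ be a prime and let $\mathcal{F}$ be a saturated fusion system on a finite $p$-group $P$. If $\mathcal{F}$ is extremely sparse, then $\mathcal{F} = \mathcal{F}_P(P \rtimes A)$, where $A$ is a cyclic group of order $q$ (acting on $P$ by automorphisms) for some prime $q \neq p$.
   Context: Fusion systems. Let $\mathcal{F}$ be a category whose objects are the subgroups of $P$, where $\mathrm{Hom}_{\mathcal F}(Q,R)$ is a set of injective group homomorphisms $Q\to R$ and composition is composition of maps. Write $Q^{\mathcal F}$ for the $\mathcal F$-isomorphism class of $Q$, $\mathrm{Hom}_P(Q,R)$ for the homomorphisms $Q\to R$ induced by conjugation by elements of $P$, and $\mathrm{Aut}_P(Q)$ for the automorphisms of $Q$ induced by conjugation by elements of $\mathrm N_P(Q)$. A subgroup $Q$ is fully $\mathcal F$-normalized if $|\mathrm N_P(Q)|\ge|\mathrm N_P(R)|$ for all $R\in Q^{\mathcal F}$. $\mathcal F$ is a saturated fusion system on $P$ if for all $Q,R\le P$: (a) if $Q\le R$, the inclusion $Q\to R$ is in $\mathcal F$; (b) if $\phi\in\mathrm{Hom}_{\mathcal F}(Q,R)$, then the induced isomorphism $Q\to\phi(Q)$ and its inverse are in $\mathcal F$; (c) $\mathrm{Hom}_P(Q,R)\subseteq\mathrm{Hom}_{\mathcal F}(Q,R)$; (d) $\mathrm{Aut}_P(P)$ is a Sylow $p$-subgroup of $\mathrm{Aut}_{\mathcal F}(P)$; (e) every $\phi\in\mathrm{Hom}_{\mathcal F}(Q,P)$ with $\phi(Q)$ fully $\mathcal F$-normalized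 extends to a morphism in $\mathrm{Hom}_{\mathcal F}(N_\phi,P)$, where $N_\phi$ is the inverse image in $\mathrm N_P(Q)$ of $\mathrm{Aut}_P(Q)\cap(\phi^{-1}\mathrm{Aut}_P(\phi(Q))\phi)$. For a finite group $G$ with Sylow $p$-subgroup $P$, $\mathcal F_P(G)$ is the saturated fusion system on $P$ whose morphisms $Q\to R$ are the restrictions to $Q$ of conjugations by $g\in G$ with $Q^g\le R$. $\mathcal F$ is trivial if $\mathcal F=\mathcal F_P(P)$. A saturated subsystem of $\mathcal F$ on $Q\le P$ is a subcategory of $\mathcal F$ which is a saturated fusion system on $Q$. A nontrivial saturated fusion system $\mathcal F$ on $P$ is extremely sparse if, for every subgroup $Q\le P$, the only proper (i.e. $\neq\mathcal F$) saturated subsystem of $\mathcal F$ on $Q$ is $\mathcal F_Q(Q)$. *)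

(* Defs.v *)
From mathcomp Require Import all_boot all_fingroup all_solvable.

Set Implicit Arguments.
Unset Strict Implicit.
Unset Printing Implicit Defensive.

Import GroupScope.

(* A homomorphism Q -> R between subgroups of gT is encoded as a finite
   function on gT equal to 1 outside Q, so that two homomorphisms are equal in
   {ffun gT -> gT} iff they agree on Q, and the composite of Q -> R -> S is
   [ffun x => g (f x)]. *)

Section Homs.

Variable gT : finGroupType.
Implicit Types (P Q R G : {group gT}) (f : {ffun gT -> gT}).

Definition restr Q (f : gT -> gT) : {ffun gT -> gT} :=
  [ffun x => if x \in Q then f x else 1].

Definition inj_hom Q R f : bool :=
  [&& f == restr Q f, morphic Q f, f @: Q \subset R & dinjectiveb f Q].

(* <<_>> only provides the group structure: see hom_imgE. *)
Definition hom_img f Q : {group gT} := [group of <<f @: Q>>].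

Lemma hom_imgE Q f : morphic Q f -> hom_img f Q = f @: Q :> {set gT}.
Proof.
move=> fM; have defQ : morphm fM @* Q = f @: Q by rewrite morphimEdom.
by rewrite /= -[in LHS]defQ genGid.
Qed.

(* The type of assignments (Q, R) |-> Hom(Q, R); Hom(Q, R) is empty when Q or R
   is not an object, so that equality of fusion systems is =2. *)
Definition hom_family := {group gT} -> {group gT} -> {set {ffun gT -> gT}}.

Implicit Types F E : hom_family.

Record hom_category P F : Prop := HomCategory {
  hom_category_obj : forall Q R f,
    f \in F Q R -> (Q \subset P) && (R \subset P);
  hom_category_inj : forall Q R f, f \in F Q R -> inj_hom Q R f;
  hom_category_id : forall Q, Q \subset P -> restr Q id \in F Q Q;
  hom_category_comp : forall Q R S f g,
    f \in F Q R -> g \in F R S -> [ffun x => g (f x)] \in F Q S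
}.

Definition Fiso F Q R : Prop :=
  exists f g, [/\ f \in F Q R, g \in F R Q, {in Q, cancel f g}
                & {in R, cancel g f}].

Definition fully_normalized P F Q : Prop :=
  Q \subset P /\ forall R, Fiso F Q R -> #|'N_P(R)| <= #|'N_P(Q)|.

Definition HomG G Q R : {set {ffun gT -> gT}} :=
  [set restr Q (fun x => x ^ g) | g in G & Q :^ g \subset R].

Definition AutF F Q : {set {perm gT}} := [set a in Aut Q | restr Q a \in F Q Q].

Definition AutP P Q : {set {perm gT}} := conj_aut Q @* 'N_P(Q).

(* f^-1 o B o f, for B a set of automorphisms of f(Q) *)
Definition aut_pullback f Q (B : {set {perm gT}}) : {set {perm gT}} :=
  [set a in Aut Q | [exists b in B, [forall x in Q, f (a x) == b (f x)]]].

Definition Nphi P Q f : {set gT} :=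
  'N_P(Q) :&:
    conj_aut Q @*^-1 (AutP P Q :&: aut_pullback f Q (AutP P (hom_img f Q))).

Lemma Nphi_group_set P Q f : group_set (Nphi P Q f).
Proof.
suff pbG : group_set (aut_pullback f Q (AutP P (hom_img f Q))).
  rewrite /Nphi /AutP -[aut_pullback _ _ _]/(gval (Group pbG)).
  exact: groupP.
apply/group_setP; split=> [|a b].
  rewrite in_set group1; apply/existsP; exists 1; rewrite group1 /=.
  by apply/forallP=> x; rewrite !perm1 eqxx implybT.
rewrite in_set => /andP[Aa /existsP[a' /andP[Pa' /forallP fa]]].
rewrite in_set => /andP[Ab /existsP[b' /andP[Pb' /forallP fb]]].
rewrite in_set groupM //=; apply/existsP; exists (a' * b').
rewrite groupM //=; apply/forallP=> x; apply/implyP=> Qx; rewrite !permM.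
have /implyP/(_ Qx)/eqP <- := fa x.
by have /implyP-> := fb (a x); rewrite // Aut_closed.
Qed.

Canonical Nphi_group P Q f := Group (Nphi_group_set P Q f).

Record saturated (p : nat) P F : Prop := Saturated {
  sat_category : hom_category P F;
  sat_incl : forall Q R,
    Q \subset P -> R \subset P -> Q \subset R -> restr Q id \in F Q R;
  sat_iso : forall Q R f, f \in F Q R ->
    f \in F Q (hom_img f Q)
    /\ exists2 g, g \in F (hom_img f Q) Q & {in Q, cancel f g};
  sat_inner : forall Q R,
    Q \subset P -> R \subset P -> HomG P Q R \subset F Q R;
  sat_sylow : p.-Sylow(AutF F P) (AutP P P);
  sat_extend : forall Q f, Q \subset P -> f \in F Q P ->
    fully_normalized P F (hom_img f Q) ->
    exists2 g, g \in F (Nphi_group P Q f) P & restr Q g = f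
}.

Definition fusion_of P G : hom_family := fun Q R =>
  if (Q \subset P) && (R \subset P) then HomG G Q R else set0.

Definition trivial_fusion P F : Prop := F =2 fusion_of P P.

Definition saturated_subsystem (p : nat) Q E F : Prop :=
  (forall R S, E R S \subset F R S) /\ saturated p Q E.

Definition extremely_sparse (p : nat) P F : Prop :=
  ~ trivial_fusion P F /\
  forall Q, Q \subset P -> forall E, saturated_subsystem p Q E F ->
    ~ (E =2 F) -> E =2 fusion_of Q Q.

End Homs.

(* The family on P obtained from a family E on i(P) by identifying P with i(P)
   along i; used for P inside the external semidirect product, whose elements
   live in another type. *)
Definition fusion_pull (gT hT : finGroupType) (P : {group gT})
    (i : {morphism P >-> hT}) (E : hom_family hT) : hom_family gT :=
  fun Q R => [set f | [&& Q \subset P, R \subset P, inj_hom Q R f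
    & [exists h in E (i @* Q)%G (i @* R)%G, [forall x in Q, i (f x) == h (i x)]]]].

Definition fusion_of_sdprod (aT gT : finGroupType) (A : {group aT})
    (P : {group gT}) (to : groupAction A P) : hom_family gT :=
  fusion_pull (sdpair1_morphism to)
    (fusion_of (sdpair1 to @* P)%G [set: sdprod_by to]%G).

(* Main.v *)
Require Import Defs.
From mathcomp Require Import all_boot all_fingroup all_solvable.

Import GroupScope.

(** If some Q <= P has an F-automorphism a of prime order q <> p, then the fusion
    system E of the semidirect product of Q by <[a]> is a saturated subsystem of
    F on Q: all its morphisms are restrictions to subgroups of Q of elements of
    B = <[a]> Inn(Q) <= Aut_F(Q). It is not the fusion system of Q itself, because
    a, being a p'-element, is not an inner automorphism of the p-group Q. Extreme
    sparseness thus forces E = F, whence Q = P, as the two families must have the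
    same objects, and F is the fusion system of the semidirect product of P by a
    cyclic group of order q.

    It remains to produce a, and by Cauchy's theorem it is enough that some
    Aut_F(Q) is not a p-group. This is the fusion system form of Frobenius'
    normal p-complement criterion (p_automizers_trivial): if every Aut_F(Q) is a
    p-group, then every morphism of F is conjugation by an element of P. The proof
    is by descending induction on |Q|. Let R be a fully normalized F-conjugate of
    Q < P. If Aut_P(R) were a proper subgroup of the p-group Aut_F(R), then some
    a in Aut_F(R), not in Aut_P(R), would normalize it; such an a extends to
    N_P(R) > R, so by induction it is induced by P, a contradiction. Hence
    Aut_F(R) = Aut_P(R), so all isomorphisms S -> R in F extend to N_P(S) > S and
    by induction are conjugations by elements of P. A morphism defined on Q is a
    quotient of two such isomorphisms.

    That E is saturated costs little: its morphisms are restrictions of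
    automorphisms of the whole of Q, so they all extend, and Inn(Q) is a normal
    Sylow p-subgroup of B because q <> p. *)

(** * Homomorphisms between subgroups as restricted functions *)

Section Restrictions.

Set Implicit Arguments.
Unset Strict Implicit.

Variable gT : finGroupType.
Implicit Types (P Q R S : {group gT}) (f g : {ffun gT -> gT}).

Lemma restrE Q (f : gT -> gT) : {in Q, restr Q f =1 f}.
Proof. by move=> x Qx; rewrite ffunE Qx. Qed.

Lemma restr_imset Q (f : gT -> gT) : restr Q f @: Q = f @: Q.
Proof. exact/eq_in_imset/restrE. Qed.

Lemma eq_restr Q (f g : gT -> gT) : {in Q, f =1 g} -> restr Q f = restr Q g.
Proof. by move=> fg; apply/ffunP=> x; rewrite !ffunE; case: ifP => // /fg. Qed.

Lemma restr_restr Q R (f : gT -> gT) :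
  Q \subset R -> restr Q (restr R f) = restr Q f.
Proof. by move=> sQR; apply: eq_restr => x /(subsetP sQR)/restrE. Qed.

Lemma inj_hom_restr Q R S (a : {perm gT}) :
  a \in Aut S -> Q \subset S -> inj_hom Q R (restr Q a) = (a @: Q \subset R).
Proof.
move=> Aa sQS; rewrite /inj_hom restr_restr // eqxx /= restr_imset.
have -> : morphic Q (restr Q a).
  apply/morphicP=> x y Qx Qy; rewrite !restrE ?groupM //.
  by have /morphicP := Aut_morphic Aa; apply; apply: (subsetP sQS).
have -> : dinjectiveb (restr Q a) Q.
  by apply/dinjectiveP=> x y Qx Qy; rewrite !restrE // => /perm_inj.
by rewrite andbT.
Qed.

Lemma restr_inj_hom Q R f (g : gT -> gT) :
  inj_hom Q R f -> {in Q, f =1 g} -> f = restr Q g.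
Proof.
by case/and4P=> /eqP-> _ _ _ fg; apply: eq_restr => x Qx; rewrite -fg ?restrE.
Qed.

Lemma hom_img_imset Q R f : inj_hom Q R f -> hom_img f Q = f @: Q :> {set gT}.
Proof. by case/and4P=> _ fM _ _; apply: hom_imgE. Qed.

Lemma hom_img_sub Q R f : inj_hom Q R f -> hom_img f Q \subset R.
Proof. by move=> fI; rewrite (hom_img_imset fI); case/and4P: fI. Qed.

Lemma mem_hom_img Q R f x : inj_hom Q R f -> x \in Q -> f x \in hom_img f Q.
Proof. by move=> fI Qx; rewrite (hom_img_imset fI) imset_f. Qed.

Lemma card_hom_img Q R f : inj_hom Q R f -> #|hom_img f Q| = #|Q|.
Proof.
move=> fI; rewrite (hom_img_imset fI); case/and4P: fI => _ _ _ /dinjectiveP.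
exact: card_in_imset.
Qed.

Lemma HomGP (G : {group gT}) Q R f :
  reflect (exists2 g, g \in G & Q :^ g \subset R /\ f = restr Q (conjg^~ g))
          (f \in HomG G Q R).
Proof.
apply: (iffP imsetP) => [[g]|[g Gg [sR ->]]].
  by rewrite inE => /andP[Gg sR ->]; exists g.
by exists g; rewrite ?inE ?Gg.
Qed.

Lemma inj_hom_aut Q f :
  inj_hom Q Q f -> exists2 a, a \in Aut Q & {in Q, a =1 f}.
Proof.
case/and4P=> _ fM sfQ /dinjectiveP finj.
have injf : 'injm (morphm fM) by apply/injmP=> x y Qx Qy; apply: finj.
have imf : morphm fM @* Q = Q.
  by apply/eqP; rewrite eqEcard card_injm // leqnn morphimEdom andbT.
by exists (aut injf imf); [apply: Aut_aut | move=> x Qx; rewrite /= autE].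
Qed.

Lemma AutPP P Q (a : {perm gT}) :
  reflect (exists2 x, x \in 'N_P(Q) & a = conj_aut Q x) (a \in AutP P Q).
Proof.
have sN : 'N_P(Q) \subset 'N(Q) by apply: subsetIr.
apply: (iffP morphimP) => [[x Nx Px ->]|[x Px ->]]; exists x => //.
exact: (subsetP sN).
Qed.

(** For x in Q, conjugation by x on Q corresponds under f to conjugation by f(x)
    on f(Q). *)
Lemma sub_Nphi P Q f :
  Q \subset P -> inj_hom Q P f -> Q \subset Nphi P Q f.
Proof.
move=> sQP fI; apply/subsetP=> x Qx.
have sfP := subsetP (hom_img_sub fI); have NQ := subsetP (normG Q).
have NR := subsetP (normG (hom_img f Q)); have fQ := mem_hom_img fI.
have fM : morphic Q f by case/and4P: fI.
have NPx : x \in 'N_P(Q) by rewrite inE (subsetP sQP) ?NQ.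
rewrite in_setI NPx inE NQ //= inE in_setI.
apply/andP; split; first by apply/AutPP; exists x.
rewrite in_set Aut_aut; apply/existsP; exists (conj_aut (hom_img f Q) (f x)).
apply/andP; split.
  by apply/AutPP; exists (f x); rewrite // inE sfP ?NR ?fQ.
apply/'forall_implyP=> y Qy; rewrite !conj_autE ?fQ //.
by rewrite -!(morphmE fM) morphJ.
Qed.

End Restrictions.

(** * Homomorphism categories: composition and automizers *)

Section HomCategory.

Set Implicit Arguments.
Unset Strict Implicit.

Variables (gT : finGroupType) (P : {group gT}) (F : hom_family gT).
Hypothesis catF : hom_category P F.
Implicit Types (Q R S T : {group gT}) (f g : {ffun gT -> gT}).

Let injF {Q R f} : f \in F Q R -> inj_hom Q R f.
Proof. exact: (hom_category_inj catF). Qed.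

Lemma hom_restr_comp Q R S f g :
  f \in F Q R -> g \in F R S -> restr Q (g \o f) \in F Q S.
Proof.
move=> Ff Fg; have Fgf := hom_category_comp catF Ff Fg.
have /(restr_inj_hom (injF Fgf)) <- // : {in Q, [ffun x => g (f x)] =1 g \o f}.
by move=> x _; rewrite ffunE.
Qed.

Lemma AutF_group_set Q : Q \subset P -> group_set (AutF F Q).
Proof.
move=> sQP; apply/group_setP; split=> [|a b].
  rewrite in_set group1 (_ : restr Q _ = restr Q id) ?(hom_category_id catF) //.
  by apply: eq_restr => x _; rewrite perm1.
rewrite in_set => /andP[Aa Fa]; rewrite in_set => /andP[Ab Fb].
rewrite in_set groupM //=.
suff -> : restr Q (a * b) = restr Q (restr Q b \o restr Q a).
  exact: hom_restr_comp Fa Fb.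
by apply: eq_restr => x Qx; rewrite /= !restrE ?permM ?Aut_closed.
Qed.

Lemma mem_AutF Q f :
  f \in F Q Q -> exists2 a, a \in AutF F Q & f = restr Q a.
Proof.
move=> Ff; have [a Aa af] := inj_hom_aut (injF Ff).
have def_f : f = restr Q a by apply: restr_inj_hom (injF Ff) _ => x /af.
by exists a; rewrite // in_set Aa -def_f.
Qed.

End HomCategory.

(** * Saturated systems whose automizers are p-groups *)

Section PGroupAutomizers.

Set Implicit Arguments.
Unset Strict Implicit.

Variables (gT : finGroupType) (p : nat) (P : {group gT}) (F : hom_family gT).
Hypotheses (pP : p.-group P) (satF : saturated p P F).
Implicit Types (Q R S T : {group gT}) (f g : {ffun gT -> gT}).

Let catF : hom_category P F. Proof. exact: sat_category satF. Qed.
Let injF {Q R f} : f \in F Q R -> inj_hom Q R f.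
Proof. exact: (hom_category_inj catF). Qed.

Lemma hom_widen Q R f : f \in F Q R -> f \in F Q P.
Proof.
move=> Ff; have /andP[_ sRP] := hom_category_obj catF Ff.
have Fi := sat_incl satF sRP (subxx P) sRP.
have := hom_restr_comp catF Ff Fi.
rewrite -(restr_inj_hom (injF Ff)) // => x Qx /=.
by rewrite restrE //; case/and4P: (injF Ff) => _ _ /subsetP-> //; apply: imset_f.
Qed.

Lemma hom_restrict Q R S T f : f \in F Q S -> R \subset Q -> T \subset P ->
  f @: R \subset T -> restr R f \in F R T.
Proof.
move=> Ff sRQ sTP fRT; have /andP[sQP _] := hom_category_obj catF Ff.
have sRP := subset_trans sRQ sQP.
have := hom_restr_comp catF (sat_incl satF sRP sQP sRQ) Ff.
rewrite (@eq_restr _ R _ f) => [Ffi|x Rx]; last by rewrite /= restrE.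
have [Ff' _] := sat_iso satF Ffi.
have imfT : hom_img (restr R f) R \subset T.
  by rewrite (hom_img_imset (injF Ff')) restr_imset.
have Fi := sat_incl satF (subset_trans imfT sTP) sTP imfT.
have := hom_restr_comp catF Ff' Fi.
rewrite (@eq_restr _ R _ f) // => x Rx.
by rewrite /= restrE ?(mem_hom_img (injF Ff')) // restrE.
Qed.

(** Among the finitely many images of Q under F-morphisms to P, one has a
    normalizer of largest order; every subgroup isomorphic to it in F is again
    such an image. *)
Lemma exists_fully_normalized Q : Q \subset P ->
  exists2 f, f \in F Q P & fully_normalized P F (hom_img f Q).
Proof.
move=> sQP; have Fi := sat_incl satF sQP (subxx P) sQP.
case: (@arg_maxnP _ _ (mem (F Q P)) (fun f => #|'N_P(hom_img f Q)|) Fi).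
move=> f Ff maxf; exists f => //; split; first exact: hom_img_sub (injF Ff).
move=> R [g [h [Fg Fh gK hK]]].
have [Ff' _] := sat_iso satF Ff.
have Fgf := hom_restr_comp catF Ff' Fg.
have := maxf _ (hom_widen Fgf); congr (_ <= _).
suff -> : hom_img (restr Q (g \o f)) Q = R by [].
apply: group_inj; rewrite (hom_img_imset (injF Fgf)).
apply/eqP; rewrite eqEcard; case/and4P: (injF Fgf) => _ _ -> _ /=.
rewrite -(hom_img_imset (injF Fgf)) (card_hom_img (injF Fgf)).
rewrite -(card_hom_img (injF Ff)) -(card_hom_img (injF Fh)).
exact/subset_leq_card/hom_img_sub/(injF Fh).
Qed.

Lemma AutP_sub_AutF Q : Q \subset P -> AutP P Q \subset AutF F Q.
Proof.
move=> sQP; apply/subsetP=> _ /AutPP[x /setIP[Px Nx] ->].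
rewrite in_set Aut_aut /=; apply: (subsetP (sat_inner satF sQP sQP)).
apply/HomGP; exists x; rewrite // (normP Nx); split=> //.
by apply: eq_restr => y Qy; apply: norm_conj_autE.
Qed.

(** Transporting a conjugation on Q along f gives an element of Aut_F(f(Q)),
    so N_f is as large as possible as soon as Aut_F(f(Q)) is induced by P. *)
Lemma Nphi_full Q f :
  f \in F Q P -> AutF F (hom_img f Q) = AutP P (hom_img f Q) ->
  Nphi P Q f = 'N_P(Q).
Proof.
move=> Ff autR; apply/setIidPl/subsetP=> x NPx; have /setIP[Px Nx] := NPx.
have /andP[sQP _] := hom_category_obj catF Ff.
have [Ff' [g Fg fK]] := sat_iso satF Ff.
rewrite inE Nx inE /= inE; apply/andP; split; first by apply/AutPP; exists x.
have : conj_aut Q x \in AutF F Q.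
  by apply: (subsetP (AutP_sub_AutF sQP)); apply/AutPP; exists x.
rewrite in_set => /andP[Aa Fa]; rewrite in_set Aa /=.
have Fgaf := hom_restr_comp catF (hom_restr_comp catF Fg Fa) Ff'.
have [b Fb /ffunP def_b] := mem_AutF catF Fgaf.
apply/existsP; exists b; rewrite -autR Fb /=; apply/forallP=> y.
apply/implyP=> Qy; have Ry := mem_hom_img (injF Ff) Qy.
have := def_b (f y); rewrite [RHS]restrE // => <-.
by rewrite restrE //= restrE //= fK // restrE.
Qed.

Hypothesis pAut : forall Q, Q \subset P -> p.-group (AutF F Q).

Lemma AutF_inner : AutF F P = AutP P P.
Proof.
have sylP := sat_sylow satF; apply/eqP; rewrite eq_sym eqEcard (pHall_sub sylP).
have card_syl := @card_Hall _ p (Group (AutF_group_set catF (subxx P)))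
  (conj_aut P @* 'N_P(P))%G sylP.
rewrite /= in card_syl; rewrite /AutP card_syl part_pnat_id ?leqnn //.
exact: (pAut (subxx P)).
Qed.

Definition P_conjugation Q f := exists2 x, x \in P & f = restr Q (conjg^~ x).

(** Normalizers grow in the p-group Aut_F(R): were Aut_P(R) smaller, it would be
    normalized by some a outside it. Since a normalizes Aut_P(R), its extension
    domain is N_P(R) > R, to which the induction hypothesis IH applies. *)
Lemma AutF_fully_normalized R : R \proper P -> fully_normalized P F R ->
  (forall S f, R \proper S -> f \in F S P -> P_conjugation S f) ->
  AutF F R = AutP P R.
Proof.
move=> prRP fnR IH; have sRP := proper_sub prRP.
pose D := Group (AutF_group_set catF sRP).
pose N := (conj_aut R @* 'N_P(R))%G.
have sND : N \subset D := AutP_sub_AutF sRP.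
have [//|ltND] := eqVproper sND.
have pD : p.-group D := pAut sRP.
have ltNND := nilpotent_proper_norm (pgroup_nil pD) ltND.
have /properP[_ [a /setIP[Da Na] nNa]] := ltNND.
case/negP: nNa; move: (Da); rewrite /D in_set => /andP[Aa Fa].
have imR : hom_img (restr R a) R = R.
  apply: group_inj; rewrite (hom_img_imset (injF Fa)) /= restr_imset.
  apply/eqP; rewrite eqEcard card_imset ?leqnn ?andbT; last exact: perm_inj.
  by apply/subsetP=> _ /imsetP[x Rx ->]; apply: Aut_closed.
have NphiR : Nphi P R (restr R a) = 'N_P(R).
  apply/setIidPl/subsetP=> x NPx; have /setIP[Px Nx] := NPx.
  have Nc : conj_aut R x \in N by apply/AutPP; exists x.
  rewrite inE Nx inE /= inE -/(AutP P R) [_ \in AutP _ _]Nc in_set Aut_aut /= imR.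
  apply/existsP; exists (conj_aut R x ^ a); rewrite [_ \in _]memJ_norm // Nc /=.
  apply/forallP=> y; apply/implyP=> Ry; rewrite !restrE ?Aut_closed ?Aut_aut //.
  by rewrite /conjg !permM permK.
have [|g Fg def_a] := sat_extend satF sRP (hom_widen Fa); first by rewrite imR.
have prRN : R \proper Nphi_group P R (restr R a).
  by rewrite /= NphiR (nilpotent_proper_norm (pgroup_nil pP)).
have [x Px def_g] := IH _ _ prRN Fg.
have ax : {in R, a =1 conjg^~ x}.
  move=> y Ry; rewrite -[LHS](restrE a Ry) -def_a restrE // def_g restrE //.
  exact: (subsetP (proper_sub prRN)).
have Nx : x \in 'N(R).
  by rewrite inE; apply/subsetP=> _ /imsetP[y Ry ->]; rewrite -ax // Aut_closed.
apply/AutPP; exists x; first exact/setIP.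
by apply: (eq_Aut Aa); rewrite ?Aut_aut // => y Ry; rewrite ax ?norm_conj_autE.
Qed.

(** Descending induction on |Q|. A morphism with fully normalized image extends
    to a larger group, where the induction hypothesis applies. In general, choose
    g on Q with fully normalized image: both g and g o f^-1 (defined on f(Q)) fall
    under the special case, and f is obtained by undoing the latter after g. *)
Lemma hom_P_conjugation Q f : f \in F Q P -> P_conjugation Q f.
Proof.
have [n] := ubnP (#|P| - #|Q|); elim: n Q f => // n IHn Q f lePQn Ff.
have /andP[sQP _] := hom_category_obj catF Ff.
have [eqQP | prQP] := eqVproper sQP.
  move: Ff; rewrite (val_inj eqQP : Q = P) => Ff; have [a] := mem_AutF catF Ff.
  rewrite AutF_inner => /AutPP[x /setIP[Px Nx] -> ->]; exists x => //.
  by apply: eq_restr => y Py; apply: norm_conj_autE.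
have IH S h : #|Q| < #|S| -> h \in F S P -> P_conjugation S h.
  move=> ltQS Fh; apply: IHn Fh; rewrite -ltnS (leq_trans _ lePQn) // ltnS.
  exact/ltn_sub2l/ltQS/proper_card.
(* S of the order of Q, not only Q itself: this is also needed for f(Q). *)
have fn_conj S h : #|S| = #|Q| -> h \in F S P ->
    fully_normalized P F (hom_img h S) -> P_conjugation S h.
  move=> eqSQ Fh fnR; have /andP[sSP _] := hom_category_obj catF Fh.
  have cR := card_hom_img (injF Fh).
  have prRP : hom_img h S \proper P.
    by rewrite properEcard (hom_img_sub (injF Fh)) cR eqSQ proper_card.
  have prSP : S \proper P by rewrite properEcard sSP eqSQ proper_card.
  have autR : AutF F (hom_img h S) = AutP P (hom_img h S).
    apply: AutF_fully_normalized prRP fnR _ => T k /proper_card.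
    by rewrite cR eqSQ; apply: IH.
  have [g Fg def_h] := sat_extend satF sSP Fh fnR.
  have prSN : S \proper Nphi_group P S h.
    by rewrite /= Nphi_full // (nilpotent_proper_norm (pgroup_nil pP)).
  have [|x Px def_g] := IH _ _ _ Fg; first by rewrite -eqSQ proper_card.
  exists x; rewrite // -def_h def_g restr_restr //; exact: proper_sub.
have [g Fg fnR] := exists_fully_normalized sQP.
have [x Px def_g] := fn_conj _ _ (erefl _) Fg fnR.
have [Ff' [k Fk fK]] := sat_iso satF Ff.
have Fgk := hom_restr_comp catF Fk Fg.
have imgk : hom_img (restr (hom_img f Q) (g \o k)) (hom_img f Q) = hom_img g Q.
  apply: group_inj; rewrite (hom_img_imset (injF Fgk)) restr_imset.
  rewrite (hom_img_imset (injF Ff)) (hom_img_imset (injF Fg)).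
  by rewrite -imset_comp; apply: eq_in_imset => y Qy /=; rewrite fK.
have [|y Py def_gk] := fn_conj _ _ (card_hom_img (injF Ff)) Fgk.
  by rewrite imgk.
exists (x * y^-1); rewrite ?groupM ?groupV //.
apply: (restr_inj_hom (injF Ff)) => z Qz.
have fz := mem_hom_img (injF Ff) Qz.
have /ffunP/(_ (f z)) := def_gk.
rewrite !restrE //= fK // def_g restrE // => def_z.
by rewrite conjgM def_z conjgK.
Qed.

Lemma p_automizers_trivial : trivial_fusion P F.
Proof.
move=> Q R; rewrite /fusion_of; case: ifP => [/andP[sQP sRP]|nsP].
  apply/eqP; rewrite eqEsubset (sat_inner satF) // andbT.
  apply/subsetP=> f Ff; have [x Px def_f] := hom_P_conjugation (hom_widen Ff).
  apply/HomGP; exists x => //; split=> //; case/and4P: (injF Ff) => _ _ + _.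
  by rewrite def_f restr_imset.
apply/setP=> f; rewrite in_set0; apply/negP=> /(hom_category_obj catF).
by rewrite nsP.
Qed.

End PGroupAutomizers.

(** * The fusion system of a group of automorphisms *)

Section AutFusion.

Set Implicit Arguments.
Unset Strict Implicit.

Variable gT : finGroupType.
Implicit Types (Q R S T : {group gT}) (f g : {ffun gT -> gT}).

(** For B containing Inn(Q), this is the fusion system on Q of the semidirect
    product of Q by B, described without reference to the elements of that product
    (see fusion_of_sdprodE). *)
Definition aut_fusion Q (B : {set {perm gT}}) : hom_family gT := fun R S =>
  [set restr R b | b : {perm gT} in B
     & [&& R \subset Q, S \subset Q & b @: R \subset S]].

Lemma aut_fusionP Q (B : {set {perm gT}}) R S f :
  reflect [/\ R \subset Q, S \subset Q
            & exists2 b : {perm gT}, b \in B & b @: R \subset S /\ f = restr R b]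
          (f \in aut_fusion Q B R S).
Proof.
apply: (iffP imsetP) => [[b]|[sRQ sSQ [b Bb [bRS ->]]]].
  by rewrite inE => /and4P[Bb sR sS bRS] ->; split=> //; exists b.
by exists b; rewrite // inE Bb sRQ sSQ.
Qed.

Section Saturation.

Variables (p : nat) (Q : {group gT}) (B : {group {perm gT}}).
Hypotheses (sBA : B \subset Aut Q) (sylB : p.-Sylow(B) (AutP Q Q)).

Let AutB b : b \in B -> b \in Aut Q. Proof. exact: (subsetP sBA). Qed.

Let aut_fusion_cat : hom_category Q (aut_fusion Q B).
Proof.
split=> [R S f|R S f|R sRQ|R S T f g].
- by case/aut_fusionP=> -> ->.
- case/aut_fusionP=> sR sS [b /AutB Ab [bRS ->]].
  by rewrite (inj_hom_restr _ Ab).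
- apply/aut_fusionP; split=> //; exists 1; rewrite ?group1 //.
  split; last by apply: eq_restr => x _; rewrite perm1.
  by apply/subsetP=> _ /imsetP[x Rx ->]; rewrite perm1.
case/aut_fusionP=> sR sS [b Bb [bRS ->]] /aut_fusionP[_ sT [c Bc [cST ->]]].
apply/aut_fusionP; split=> //; exists (b * c); first exact: groupM.
split.
  apply/subsetP=> _ /imsetP[x Rx ->]; rewrite permM.
  exact/(subsetP cST)/imset_f/(subsetP bRS)/imset_f.
have Ac := Aut_morphic (AutB Bc).
apply/ffunP=> x; rewrite !ffunE; case Rx: (x \in R).
  by rewrite permM (subsetP bRS) ?imset_f.
(* outside R, the composite takes the value c 1 *)
by rewrite group1 -(morphmE Ac) morph1.
Qed.

(** The extension axiom holds with room to spare, because every morphism is the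
    restriction of an automorphism of the whole of Q; the Sylow axiom is the
    hypothesis on B, which is the automizer of Q. *)
Lemma aut_fusion_saturated : saturated p Q (aut_fusion Q B).
Proof.
have id_imset R : (1 : {perm gT}) @: R = R.
  by rewrite -[RHS]imset_id; apply: eq_imset => x; rewrite perm1.
split=> // [R S sRQ sSQ sRS|R S f|R S sRQ sSQ||R f sRQ Ef _].
- apply/aut_fusionP; split=> //; exists 1; rewrite ?group1 // id_imset.
  by split=> //; apply: eq_restr => x _; rewrite perm1.
- move=> Ef; have fI := hom_category_inj aut_fusion_cat Ef.
  have sfS := hom_img_sub fI; have imf := hom_img_imset fI.
  case/aut_fusionP: Ef => sR sS [b Bb [bRS def_f]].
  have sfQ := subset_trans sfS sS.
  have {}imf : hom_img f R = b @: R :> {set gT} by rewrite imf def_f restr_imset.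
  split; first by apply/aut_fusionP; split=> //; exists b; rewrite // imf.
  exists (restr (hom_img f R) b^-1).
    apply/aut_fusionP; split=> //; exists b^-1; rewrite ?groupV // imf.
    by split=> //; apply/subsetP=> _ /imsetP[_ /imsetP[x Rx ->] ->]; rewrite permK.
  by move=> x Rx; rewrite restrE ?imf def_f restrE ?imset_f // permK.
- apply/subsetP=> _ /HomGP[x Qx [xRS ->]]; apply/aut_fusionP; split=> //.
  have eqx : {in R, conj_aut Q x =1 conjg^~ x}.
    by move=> y Ry; rewrite conj_autE //; apply: (subsetP sRQ).
  exists (conj_aut Q x).
    apply: (subsetP (pHall_sub sylB)); apply/AutPP; exists x => //.
    by rewrite inE Qx (subsetP (normG Q)).
  by split; [rewrite (eq_in_imset eqx) | rewrite (eq_restr eqx)].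
- suff -> : AutF (aut_fusion Q B) Q = B by [].
  apply/setP=> a; rewrite in_set; apply/andP/idP=> [[Aa]|Ba].
    case/aut_fusionP=> _ _ [b Bb [_ /ffunP eq_ab]].
    suff -> : a = b by [].
    apply: (eq_Aut Aa (AutB Bb)) => x Qx.
    by have := eq_ab x; rewrite !restrE.
  split; first exact: AutB.
  apply/aut_fusionP; split=> //; exists a => //.
  by split=> //; apply/subsetP=> _ /imsetP[x Qx ->]; rewrite Aut_closed ?AutB.
have [_ _ [b Bb [_ def_f]]] := aut_fusionP _ _ _ _ _ Ef.
have sNQ : Nphi_group Q R f \subset Q.
  by apply/subsetP=> x; rewrite /= => /setIP[/setIP[]].
exists (restr (Nphi_group Q R f) b).
  apply/aut_fusionP; split=> //; exists b => //; split=> //.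
  apply/subsetP=> _ /imsetP[x Nx ->].
  by rewrite Aut_closed ?AutB // (subsetP sNQ).
have fI := hom_category_inj aut_fusion_cat Ef.
by rewrite [in RHS]def_f restr_restr // (sub_Nphi sRQ fI).
Qed.

End Saturation.

Lemma Aut_norm_inner Q (A : {set {perm gT}}) :
  A \subset Aut Q -> A \subset 'N(AutP Q Q).
Proof.
move=> sAQ; apply/subsetP=> a /(subsetP sAQ) Aa; rewrite inE.
apply/subsetP=> _ /imsetP[_ /AutPP[x /setIP[Qx Nx] ->] ->]; apply/AutPP.
have Qax := Aut_closed Aa Qx.
exists (a x); first by rewrite inE Qax (subsetP (normG Q)).
have Aca : conj_aut Q x ^ a \in Aut Q by rewrite groupJ // Aut_aut.
apply: (eq_Aut Aca (Aut_aut _ _)) => y Qy.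
have Qa'y : a^-1 y \in Q by apply: Aut_closed; rewrite ?groupV.
rewrite /conjg !permM !conj_autE //.
by rewrite -(autmE Aa) morphJ //= !autmE permKV.
Qed.

Lemma inner_Sylow (p : nat) Q (A : {group {perm gT}}) :
  p.-group Q -> A \subset Aut Q -> p^'.-group A ->
  p.-Sylow(A <*> AutP Q Q) (AutP Q Q).
Proof.
move=> pQ sAQ p'A; pose N := (conj_aut Q @* 'N_Q(Q))%G.
have nNA : A \subset 'N(N) := Aut_norm_inner sAQ.
have pN : p.-group N by rewrite morphim_pgroup // (pgroupS (subsetIl _ _)).
have tiAN : coprime #|A| #|N| by rewrite coprime_sym (pnat_coprime pN).
rewrite -[AutP Q Q]/(gval N) pHallE joing_subr /= norm_joinEl //.
by rewrite coprime_cardMg // partnM // part_p'nat // mul1n part_pnat_id.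
Qed.

Lemma aut_fusion_nontrivial (p : nat) Q (B : {set {perm gT}}) (a : {perm gT}) :
    p.-group Q -> B \subset Aut Q -> a \in B -> ~~ p.-elt a ->
  ~ aut_fusion Q B =2 fusion_of Q Q.
Proof.
move=> pQ sBA Ba np_a eqE; have Aa := subsetP sBA a Ba.
have : restr Q a \in aut_fusion Q B Q Q.
  apply/aut_fusionP; split=> //; exists a => //; split=> //.
  by apply/subsetP=> _ /imsetP[x Qx ->]; apply: Aut_closed.
rewrite eqE /fusion_of subxx => /HomGP[x Qx [_ /ffunP eq_ax]].
have NQx : x \in 'N_Q(Q) by rewrite inE Qx (subsetP (normG Q)).
have def_a : a = conj_aut Q x.
  apply: (eq_Aut Aa (Aut_aut _ _)) => y Qy.
  by have := eq_ax y; rewrite !restrE // conj_autE.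
case/negP: np_a; apply: (@mem_p_elt _ _ _ (conj_aut Q @* 'N_Q(Q))%G).
  by rewrite morphim_pgroup // (pgroupS (subsetIl _ _)).
by apply/AutPP; exists x.
Qed.

Lemma aut_fusion_sub (p : nat) P Q (F : hom_family gT) (B : {set {perm gT}}) R S :
    saturated p P F -> Q \subset P -> B \subset AutF F Q ->
  aut_fusion Q B R S \subset F R S.
Proof.
move=> satF sQP sBF; apply/subsetP=> f /aut_fusionP[sRQ sSQ [b Bb [bRS ->]]].
have := subsetP sBF b Bb; rewrite in_set => /andP[_ Fb].
rewrite -(restr_restr b sRQ); apply: (hom_restrict satF Fb) => //.
  exact: subset_trans sQP.
by rewrite -restr_imset restr_restr // restr_imset.
Qed.

(** An element of the semidirect product is some a in A times some y in Q, and it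
    conjugates x in Q to (a x)^y. *)
Lemma fusion_of_sdprodE Q (A : {group {perm gT}}) (sAQ : A \subset Aut Q) :
  fusion_of_sdprod ([Aut Q] \ sAQ)%gact =2 aut_fusion Q (A <*> AutP Q Q).
Proof.
set to := ([Aut Q] \ sAQ)%gact; set i := sdpair1_morphism to.
pose N := (conj_aut Q @* 'N_Q(Q))%G.
have injI : {in Q &, injective i} by apply/injmP/injm_sdpair1.
have conj_sd a x y : a \in A -> x \in Q -> y \in Q ->
    i x ^ (sdpair2 to a * i y) = i ((a * conj_aut Q y) x).
  move=> Aa Qx Qy; have Qax : a x \in Q by rewrite Aut_closed ?(subsetP sAQ).
  by rewrite conjgM -sdpair_act // -morphJ // permM conj_autE.
move=> R S; apply/setP=> f; rewrite /fusion_of_sdprod /fusion_pull inE.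
have mem_B b : (b \in A <*> AutP Q Q) =
    [exists a in A, exists y in Q, b == a * conj_aut Q y].
  rewrite -[AutP Q Q]/(gval N) norm_joinEl ?(Aut_norm_inner sAQ) //.
  apply/mulsgP/exists_inP=> [[a _ Aa /AutPP[y /setIP[Qy _] ->] ->]|[a Aa]].
    by exists a => //; apply/exists_inP; exists y.
  case/exists_inP=> y Qy /eqP->; exists a (conj_aut Q y) => //.
  by apply/AutPP; exists y; rewrite // inE Qy (subsetP (normG Q)).
apply/and4P/aut_fusionP=> [[sRQ sSQ injf /exists_inP[h]]|[sRQ sSQ [b]]].
  rewrite /fusion_of !morphimS //= => /HomGP[g _ [gRS ->]] /'forall_implyP fg.
  have : g \in sdpair2 to @* A * i @* Q.
    by rewrite (normC (im_sdpair_norm to)) im_sdpair inE.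
  case/mulsgP=> _ _ /morphimP[a _ Aa ->] /morphimP[y _ Qy ->] def_g.
  have fE : {in R, f =1 a * conj_aut Q y}.
    move=> x Rx; have Qx := subsetP sRQ x Rx.
    have Qfx : f x \in Q.
      case/and4P: injf => _ _ /subsetP sfS _.
      by rewrite (subsetP sSQ) ?sfS ?imset_f.
    apply: injI => //.
      by rewrite permM Aut_closed ?Aut_aut ?Aut_closed ?(subsetP sAQ).
    apply: etrans (eqP (fg x Rx)) _.
    by rewrite restrE ?mem_morphim // def_g conj_sd.
  split=> //; exists (a * conj_aut Q y).
    rewrite mem_B; apply/exists_inP; exists a => //.
    by apply/exists_inP; exists y.
  split; last exact: (restr_inj_hom injf fE).
  by rewrite -(eq_in_imset fE); case/and4P: injf.
rewrite mem_B => /exists_inP[a Aa /exists_inP[y Qy /eqP->]] [bRS def_f].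
have Ab : a * conj_aut Q y \in Aut Q by rewrite groupM ?Aut_aut ?(subsetP sAQ).
split=> //; first by rewrite def_f (inj_hom_restr _ Ab).
apply/exists_inP; exists (restr (i @* R) (conjg^~ (sdpair2 to a * i y))).
  rewrite /fusion_of !morphimS //=; apply/HomGP.
  exists (sdpair2 to a * i y) => //.
  split=> //; apply/subsetP=> _ /imsetP[_ /morphimP[x Qx Rx ->] ->].
  by rewrite /= conj_sd // mem_morphim ?(subsetP bRS) ?imset_f // Aut_closed.
apply/'forall_implyP=> x Rx; have Qx := subsetP sRQ x Rx.
by rewrite restrE ?mem_morphim // conj_sd // def_f restrE.
Qed.

End AutFusion.

(** * Extremely sparse fusion systems *)

Theorem theorem5p3 (gT : finGroupType) (p : nat) (P : {group gT})
    (F : hom_family gT) :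
  prime p -> p.-group P -> saturated p P F -> extremely_sparse p P F ->
  exists (q : nat) (aT : finGroupType) (A : {group aT}) (to : groupAction A P),
    [/\ prime q, q != p, cyclic A, #|A| = q & F =2 fusion_of_sdprod to].
Proof.
move=> _ pP satF [ntF sparse]; have catF := sat_category satF.
have [Q sQP np'Q] :
    exists2 Q : {group gT}, Q \subset P & ~~ p.-group (AutF F Q).
  have [allp|] :=
      boolP [forall Q : {group gT}, (Q \subset P) ==> p.-group (AutF F Q)].
    case: ntF; apply: p_automizers_trivial pP satF _ => Q.
    exact/implyP/(forallP allp).
  by case/forallPn=> Q; rewrite negb_imply => /andP[]; exists Q.
pose D := Group (AutF_group_set catF sQP).
have [q q_pr [qp qD]] : exists2 q, prime q & q != p /\ q %| #|D|.
  have [/hasP[q]|/hasPn allp] := boolP (has (predC (pred1 p)) (primes #|D|)).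
    by rewrite mem_primes => /and3P[q_pr _ qD] /= qp; exists q.
  case/negP: np'Q; rewrite /pgroup -[#|_|]/#|D|; apply/pnatP=> // q q_pr qD.
  by have := allp q; rewrite mem_primes q_pr cardG_gt0 qD negbK => /(_ isT).
have [a Da oa] := Cauchy q_pr qD; pose A := <[a]>%G.
have sAQ : A \subset Aut Q.
  by rewrite cycle_subG; move: Da; rewrite inE /= in_set => /andP[].
have pQ := pgroupS sQP pP; pose B := (A <*> (conj_aut Q @* 'N_Q(Q)))%G.
have p'A : p^'.-group A by rewrite /pgroup -[#|_|]/#[a] oa pnatE.
have sBA : B \subset Aut Q by rewrite join_subG sAQ Aut_conj_aut.
have sylB : p.-Sylow(B) (AutP Q Q) := inner_Sylow pQ sAQ p'A.
have sBD : B \subset D.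
  rewrite join_subG cycle_subG Da /=.
  exact: subset_trans (morphimS _ (setSI _ sQP)) (AutP_sub_AutF satF sQP).
have satE := aut_fusion_saturated sBA sylB.
have sEF R S : aut_fusion Q B R S \subset F R S := aut_fusion_sub R S satF sQP sBD.
have ntE : ~ aut_fusion Q B =2 fusion_of Q Q.
  apply: (aut_fusion_nontrivial pQ sBA (a := a)).
    by rewrite (subsetP (joing_subl _ _)) ?cycle_id.
  by rewrite /p_elt oa pnatE // inE /= (negPf qp).
have [/forallP eqEF|neqEF] :=
    boolP [forall R, forall S, aut_fusion Q B R S == F R S]; last first.
  case: ntE; apply: (sparse Q sQP _ (conj sEF satE)) => eqEF.
  by case/negP: neqEF; apply/forallP=> R; apply/forallP=> S; rewrite eqEF.
have {}eqEF : aut_fusion Q B =2 F.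
  by move=> R S; apply/eqP; move/forallP: (eqEF R).
(* the identity of P is a morphism of F, hence P is an object of a system on Q *)
have defQ : Q = P.
  apply: group_inj; apply/eqP; rewrite eqEsubset sQP /=.
  by have := hom_category_id catF (subxx P); rewrite -eqEF => /aut_fusionP[].
move: sAQ eqEF; rewrite /B defQ => sAP eqEF.
exists q, _, A, ([Aut P] \ sAP)%gact; split; rewrite ?cycle_cyclic //.
by move=> R S; rewrite fusion_of_sdprodE eqEF.
Qed.
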